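(* Let $G$ be a finite simple graph of order $n$ with no connected component of order less than $3$, such that every bipartite connected component of $G$ has both color classes of even order. Then $k(G)=n$ if $n\not\equiv 2\pmod 4$, and $k(G)=n+1$ if $n\equiv 2\pmod 4$.
   Context: The modular edge-gracefulness $k(G)$ of a graph $G$ of order $n$ is the smallest integer $k\geq n$ for which there exists an edge labeling $f:E(G)\rightarrow\mathbb{Z}_k$ such that the induced vertex labeling $f'(u)=\sum_{v\in N(u)} f(uv) \bmod k$ is one-to-one. The color classes of a bipartite connected component are the two parts of its (unique) bipartition. *)

(* Defs.v *)
From mathcomp Require Import all_boot all_order all_algebra.

Set Implicit Arguments.
Unset Strict Implicit.
Unset Printing Implicit Defensive.

Import GRing.Theory.
Local Open Scope ring_scope.

Section ModularEdgeGracefulness.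

(* A finite simple graph is a symmetric irreflexive adjacency relation e on a
   finite vertex type T; its order is #|T|, its edges are the sets [set u; v]
   with e u v. *)
Variables (T : finType) (e : rel T).

Definition components : {set {set T}} :=
  equivalence_partition (connect e) [set: T].

Definition color_classes (C A B : {set T}) : Prop :=
  [/\ A :|: B = C,
      [disjoint A & B],
      {in A &, forall u v, ~~ e u v} &
      {in B &, forall u v, ~~ e u v}].

(* The labeling f is total on {set T}, but only its values at edges are used. *)
Definition induced_label (k : nat) (f : {set T} -> 'Z_k) (u : T) : 'Z_k :=
  \sum_(v | e u v) f [set u; v].

(* 'Z_0 and 'Z_1 are both the integers mod 2.  Since only k >= #|T| is
   considered below, this affects only graphs with at most one vertex, for
   which injectivity holds trivially for every modulus. *)
Definition has_modular_labeling (k : nat) : Prop :=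
  exists f : {set T} -> 'Z_k, injective (induced_label f).

(* "k(G) = k".  A relation, since k(G) need not exist for an arbitrary G
   (for instance if G has a component of order 2). *)
Definition modular_edge_gracefulness (k : nat) : Prop :=
  [/\ (#|T| <= k)%N,
      has_modular_labeling k &
      forall k' : nat, (#|T| <= k')%N -> has_modular_labeling k' ->
        (k <= k')%N].

End ModularEdgeGracefulness.

(* Main.v *)
Require Import Defs.
From mathcomp Require Import all_boot all_order all_algebra.
From mathcomp Require Import zify ring.

Set Implicit Arguments.
Unset Strict Implicit.
Unset Printing Implicit Defensive.

Import GRing.Theory.

(** Alternating labels a, -a, a, ... along a walk change the vertex sums only at
    its two ends.  Hence, writing d_x for the indicator function of x, the
    vertex labeling a (d_x - d_y) is attainable for x, y in one color class of a
    bipartite component or in one non-bipartite component, a (d_x + d_y) for x,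
    y in opposite color classes, and 2 a d_x for x in a non-bipartite component.

    Split the vertices into pairs lying in a common color class (or a common
    non-bipartite component) and leftover vertices, at most one per odd
    non-bipartite component; pairs receive the values i, -i.  If the modulus k
    is odd, every value is of the form 2 a, so the leftover vertices can take
    any of the remaining values.  If k = n = 4m, they must take even values: 0,
    2m and some pairs 2i, -2i.  If there is no leftover vertex, then either a
    pair in a non-bipartite component takes 0, 2m, or two pairs in opposite
    color classes of a component take 0, m and 2m, 3m. *)

(** * Pairing the entries of a list, and checking lists of values *)

Lemma exists_pairing (T I : eqType) (p : T -> I) (s : seq T) :
  exists ps : seq (T * T), exists ss : seq T,
    [/\ perm_eq (unzip1 ps ++ unzip2 ps ++ ss) s,
        all (fun P => p P.1 == p P.2) ps & uniq (map p ss)].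
Proof.
elim: s => [|x s [ps [ss [perm_s ps_p ss_p]]]]; first by exists [::], [::].
have cnt a : count a s =
    (count a (unzip1 ps) + count a (unzip2 ps) + count a ss)%N.
  by have /permP <- := perm_s; rewrite !count_cat addnA.
case: (boolP (p x \in map p ss)) => [/mapP[y y_ss pxy]|px]; last first.
  exists ps, (x :: ss); split=> //=; last by rewrite px.
  by apply/permP => a; rewrite !count_cat /= cnt; lia.
exists ((x, y) :: ps), (rem y ss); split=> /=.
- apply/permP => a; rewrite /= !(count_cat, =^~ addnA) /= count_cat cnt.
  by have /permP /(_ a) /= := perm_to_rem y_ss; lia.
- by rewrite pxy eqxx.
- exact: subseq_uniq (map_subseq p (rem_subseq y ss)) ss_p.
Qed.

(** Pigeonhole: covering [k] values with [k] entries leaves no room for a repetition or a larger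
    entry. Explicit lists of values then need only a membership check. *)
Lemma uniq_covering k (ns : seq nat) : size ns = k ->
  (forall j, (j < k) -> j \in ns) -> uniq ns && all (ltn^~ k) ns.
Proof.
move=> sz cover.
have sub : {subset iota 0 k <= ns} by move=> j; rewrite mem_iota => /cover.
have sz_le : (size ns <= size (iota 0 k)) by rewrite size_iota sz.
rewrite (leq_size_uniq (iota_uniq 0 k) sub sz_le) /=; apply/allP => j.
by have [_ <-] := uniq_min_size (iota_uniq 0 k) sub sz_le; rewrite mem_iota.
Qed.

(** [X] and its reflection give the opposite residues other than multiples of [m], which are kept
    for two special pairs of vertices. *)
Lemma bipartite_values_uniq m : (0 < m) ->
  let X := (iota 1 m.-1 ++ iota m.+1 m.-1) in
  let ns := (X ++ [seq 4 * m - i | i <- X]) ++ [:: 0; m; 2 * m; 3 * m] in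
  uniq ns /\ all (ltn^~ (4 * m)) ns.
Proof.
move=> m_gt0 X ns; apply/andP; apply: uniq_covering.
  by rewrite !(size_cat, size_map, size_iota) /=; lia.
have in_X j : (0 < j < 2 * m) -> j != m -> j \in X.
  by rewrite mem_cat !mem_iota; lia.
move=> j j_k; rewrite mem_cat mem_cat -orbA.
have [j_Y|] := boolP (j \in [:: 0; m; 2 * m; 3 * m]); first by rewrite !orbT.
rewrite !inE orbF !negb_or => /and4P[j0 jm j2m j3m].
have [j_lt|j_ge] := ltnP j (2 * m); first by rewrite in_X //; lia.
suff -> : j \in [seq 4 * m - i | i <- X] by rewrite orbT.
by apply/mapP; exists (4 * m - j); [apply: in_X|]; lia.
Qed.

(** * The double cover, blocks and color classes *)

Section Attainable.

Local Open Scope ring_scope.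

Variables (T : finType) (e : rel T).
Hypotheses (e_sym : symmetric e) (e_irr : irreflexive e).

(** The boolean records the parity of the length of a walk in [e], so connectivity here tells which
    parities occur between two vertices. *)
Definition double_cover : rel (T * bool) :=
  [rel x y | e x.1 y.1 && (x.2 != y.2)].

(* On a bipartite component the blocks are the color classes; a non-bipartite
   component is a single block. *)
Definition block (v : T) : T * bool := fingraph.root double_cover (v, true).

(* Reachability of (v, false) from (v, true) is the existence of a closed walk
   of odd length at v, i.e. v lies in a non-bipartite component. *)
Definition odd_closed (v : T) : bool :=
  connect double_cover (v, true) (v, false).

Lemma double_cover_csym : connect_sym double_cover.
Proof.
apply: sym_connect_sym => x y.
by rewrite /double_cover /= e_sym [y.2 == _]eq_sym.
Qed.

Lemma eq_block u v :
  (block u == block v) = connect double_cover (u, true) (v, true).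
Proof. exact: root_connect double_cover_csym _ _. Qed.

(** Exchanging the two sheets is an automorphism of the double cover. *)
Lemma double_cover_flip x y : connect double_cover x y ->
  connect double_cover (x.1, ~~ x.2) (y.1, ~~ y.2).
Proof.
case/connectP => p p_path ->; elim: p x p_path => [|z p IH] x //=.
case/andP => /andP[e_xz xz] /IH; apply: connect_trans.
apply: connect1; rewrite /double_cover /= e_xz /=.
by case: (x.2) (z.2) xz => [] [].
Qed.

Lemma double_cover_edge u v b : e u v ->
  connect double_cover (u, b) (v, ~~ b).
Proof.
by move=> e_uv; apply: connect1; rewrite /double_cover /= e_uv; case: b.
Qed.

Lemma odd_closed_block u v :
  block u = block v -> odd_closed u -> odd_closed v.
Proof.
move/eqP; rewrite eq_block => uv ou.
apply: connect_trans (double_cover_flip uv).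
by apply: connect_trans ou; rewrite double_cover_csym.
Qed.

Lemma connect_double_cover u v b : connect e u v ->
  exists c, connect double_cover (u, b) (v, c).
Proof.
case/connectP => p p_path ->; elim: p u b p_path => [|z p IH] u b /=.
  by exists b.
case/andP => e_uz /(IH _ (~~ b)) [c zc]; exists c.
exact: connect_trans (double_cover_edge b e_uz) zc.
Qed.

Lemma double_cover_connect x y :
  connect double_cover x y -> connect e x.1 y.1.
Proof.
case/connectP => p p_path ->; elim: p x p_path => [|z p IH] x //=.
by case/andP => /andP[e_xz _] /IH; apply: connect_trans; apply: connect1.
Qed.

Lemma bipartite_color_classes v : ~~ odd_closed v ->
  color_classes e [set u in [set: T] | connect e v u]
    [set u | connect double_cover (v, true) (u, true)]
    [set u | connect double_cover (v, true) (u, false)].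
Proof.
move=> bip_v.
(* Walks of both parities from [v] to [u] would combine into an odd closed walk at [v]. *)
have not_both u b : connect double_cover (v, true) (u, b) ->
    connect double_cover (v, true) (u, ~~ b) -> False.
  move=> vu /double_cover_flip /=; rewrite negbK double_cover_csym => uv.
  by move/negP: bip_v; apply; apply: connect_trans uv.
split.
- apply/setP => u; rewrite !inE /=.
  apply/orP/idP => [[]/double_cover_connect //|].
  by case/(connect_double_cover true) => [] []; [left | right].
- rewrite disjoints_subset; apply/subsetP => u; rewrite !inE => vu.
  by apply/negP => /(not_both u true vu).
- move=> u w; rewrite !inE => vu vw.
  apply/negP => /(double_cover_edge true) uw.
  exact: not_both vw (connect_trans vu uw).
- move=> u w; rewrite !inE => vu vw.
  apply/negP => /(double_cover_edge false) uw.
  exact: not_both vw (connect_trans vu uw).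
Qed.

(** * Attainable vertex labelings modulo [k] *)

Section Modulus.

Variable k : nat.
Implicit Type g : T -> 'Z_k.

Definition attainable g : Prop :=
  exists f : {set T} -> 'Z_k, forall u, induced_label e f u = g u.

Lemma eq_attainable g1 g2 : g1 =1 g2 -> attainable g1 -> attainable g2.
Proof. by move=> eq_g [f fE]; exists f => u; rewrite fE. Qed.

Lemma attainable0 : attainable (fun _ => 0).
Proof. by exists (fun _ => 0) => u; apply: big1. Qed.

Lemma attainableD g1 g2 : attainable g1 -> attainable g2 ->
  attainable (fun u => g1 u + g2 u).
Proof.
move=> [f1 f1E] [f2 f2E]; exists (fun E => f1 E + f2 E) => u.
by rewrite -f1E -f2E -big_split.
Qed.

Lemma attainable_edge u w a : e u w ->
  attainable (fun z => a *+ (u == z) + a *+ (w == z)).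
Proof.
move=> e_uw; exists (fun E => if E == [set u; w] then a else 0) => z.
have uw : u != w by apply/eqP => uw; rewrite uw e_irr in e_uw.
have star x y : e x y -> x != y ->
    \sum_(v | e x v) (if [set x; v] == [set x; y] then a else 0) = a.
  move=> e_xy xy; rewrite (bigD1 y) //= eqxx big1 ?addr0 // => v /andP[_ vy].
  case: eqP => // /setP /(_ y); rewrite !inE eqxx orbT [y == x]eq_sym.
  by rewrite (negbTE xy) [y == v]eq_sym (negbTE vy).
rewrite /induced_label; case: (eqVneq u z) => [<-|uz].
  by rewrite star // [w == u]eq_sym (negbTE uw) addr0.
case: (eqVneq w z) => [<-|wz].
  by rewrite setUC star ?add0r // ?[w == u]eq_sym // e_sym.
rewrite big1 ?addr0 // => v _; case: eqP => // /setP /(_ z).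
by rewrite !inE eqxx ![z == _]eq_sym (negbTE uz) (negbTE wz).
Qed.

(* Labeling the edges of a walk alternately by a and -a only changes the sums
   at its two ends. *)
Lemma attainable_walk x y a : connect double_cover x y ->
  attainable (fun z => a *+ (x.1 == z) +
                       (if x.2 == y.2 then - a else a) *+ (y.1 == z)).
Proof.
case/connectP => p p_path ->; elim: p x a p_path => [|x' p IH] x a /=.
  move=> _; apply: eq_attainable attainable0 => z.
  by rewrite eqxx mulNrn subrr.
case/andP => /andP[e_xx' xx'] /(IH _ (- a)) att.
apply: eq_attainable (attainableD (attainable_edge a e_xx') att) => z.
rewrite mulNrn addrA addrK; congr (_ + _ *+ _).
by case: (x.2) (x'.2) ((last x' p).2) xx' => [] [] []; rewrite ?opprK.
Qed.

(** Values are natural numbers, so that distinctness modulo [k] reduces to distinctness below [k].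
    The sizes must agree because [zip] truncates. *)
Definition attainable_on (vs : seq T) (ns : seq nat) : Prop :=
  size vs = size ns /\
  attainable (fun z => \sum_(P <- zip vs ns) (P.2)%:R *+ (P.1 == z)).

Lemma attainable_on_nil : attainable_on [::] [::].
Proof.
by split=> //; apply: eq_attainable attainable0 => z; rewrite big_nil.
Qed.

Lemma attainable_on_cat vs1 ns1 vs2 ns2 :
  attainable_on vs1 ns1 -> attainable_on vs2 ns2 ->
  attainable_on (vs1 ++ vs2) (ns1 ++ ns2).
Proof.
move=> [sz1 att1] [sz2 att2]; split; first by rewrite !size_cat sz1 sz2.
apply: eq_attainable (attainableD att1 att2) => z.
by rewrite zip_cat // big_cat.
Qed.

(** An odd closed walk at [s], labeled alternately by [a] and [-a], contributes [a] twice at [s]. *)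
Lemma attainable_on_singles ss ns :
  size ss = size ns -> all odd_closed ss ->
  (forall y, y \in ns -> exists a : 'Z_k, y%:R = a + a) ->
  attainable_on ss ns.
Proof.
elim: ss ns => [|s ss IH] [|y ns] //=.
  by move=> *; apply: attainable_on_nil.
case=> sz /andP[odd_s odd_ss] even_ns.
apply: (@attainable_on_cat [:: s] [:: y]); last first.
  by apply: IH => // z z_ns; apply: even_ns; rewrite inE z_ns orbT.
split=> //; have [a ya] := even_ns y (mem_head _ _).
apply: eq_attainable (attainable_walk a odd_s) => z /=.
by rewrite big_seq1 /= ya mulrnDl.
Qed.

(** A walk of even length joins the members of a pair; starting it with the label [i] gives them [i]
    and [-i], that is [k - i]. *)
Lemma attainable_on_pairs ps ns :
  (1 < k)%N -> size ps = size ns ->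
  all (fun P => block P.1 == block P.2) ps -> all (leq^~ k) ns ->
  attainable_on (unzip1 ps ++ unzip2 ps) (ns ++ [seq k - i | i <- ns]%N).
Proof.
move=> k_gt1 sz ps_block ns_k; split.
  by rewrite !size_cat !size_map sz.
elim: ps ns sz ps_block ns_k => [|[u v] ps IH] [|i ns] //=.
  by case: attainable_on_nil.
case=> sz /andP[uv ps_block] /andP[i_k ns_k].
rewrite eq_block in uv.
apply: eq_attainable (attainableD (attainable_walk i%:R uv)
                                  (IH _ sz ps_block ns_k)).
move=> z /=; rewrite big_cons !zip_cat ?size_map //= !big_cat /= big_cons /=.
have kR0 : k%:R = 0 :> 'Z_k by rewrite char_Zp.
by rewrite natrB // kR0 sub0r; ring.
Qed.

Lemma attainable_on_labeling vs ns :
  (1 < k)%N -> attainable_on vs ns -> perm_eq vs (enum T) ->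
  uniq ns -> all (ltn^~ k) ns -> has_modular_labeling e k.
Proof.
move=> k_gt1 [sz [f fE]] vs_T ns_uniq ns_k; exists f.
have vs_all v : v \in vs by rewrite (perm_mem vs_T) mem_enum.
have vs_uniq : uniq vs by rewrite (perm_uniq vs_T) enum_uniq.
have labE v : induced_label e f v = (nth 0%N ns (index v vs))%:R.
  rewrite fE (big_nth (v, 0%N)) size1_zip ?sz // big_mkord.
  have iv : (index v vs < size ns)%N by rewrite -sz index_mem.
  rewrite (bigD1 (Ordinal iv)) //= nth_zip //= nth_index // eqxx big1 ?addr0 //.
  move=> [j j_lt] /= ji; rewrite nth_zip //=.
  case: eqP => // jv; case/eqP: ji; apply: val_inj => /=.
  by rewrite -jv index_uniq // sz.
move=> u v; rewrite !labE => /(congr1 val) /=.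
have lt_k w : (nth 0%N ns (index w vs) < k)%N.
  by apply: (allP ns_k); apply: mem_nth; rewrite -sz index_mem.
rewrite !val_Zp_nat // !modn_small // => /eqP.
rewrite nth_uniq -?sz ?index_mem // => /eqP uv.
by rewrite -(nth_index u (vs_all u)) uv nth_index.
Qed.

End Modulus.

(** * Pairing the vertices within blocks *)

Hypothesis has_neighbor : forall v, exists w, e v w.
Hypothesis bipartite_even : forall v, ~~ odd_closed v ->
  ~~ odd #|[set u | connect double_cover (v, true) (u, true)]|.

Lemma exists_block_pairing : exists ps : seq (T * T), exists ss : seq T,
  [/\ perm_eq (unzip1 ps ++ unzip2 ps ++ ss) (enum T),
      all (fun P => block P.1 == block P.2) ps, all odd_closed ss &
      (size ss <= size ps)%N].
Proof.
have [ps [ss [perm_T ps_block ss_block]]] := exists_pairing block (enum T).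
have in_T v : v \in unzip1 ps ++ unzip2 ps ++ ss.
  by rewrite (perm_mem perm_T) mem_enum.
have uniq_T : uniq (unzip1 ps ++ unzip2 ps ++ ss).
  by rewrite (perm_uniq perm_T) enum_uniq.
(* Besides [s], its block consists of whole pairs, so it has odd order; a bipartite block is a color
   class, of even order. *)
have odd_ss : all odd_closed ss.
  apply/allP => s s_ss; apply/negPn/negP => /bipartite_even.
  rewrite cardsE cardE /enum_mem -enumT size_filter.
  pose a := [pred u | block s == block u].
  rewrite (eq_count (a2 := a)) => [|u]; last by rewrite !inE eq_block.
  have one : count a ss = 1%N.
    transitivity (count_mem (block s) (map block ss)).
      by rewrite count_map; apply: eq_count => u /=; rewrite eq_sym.
    by rewrite count_uniq_mem // map_f.
  have same : count a (unzip1 ps) = count a (unzip2 ps).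
    rewrite !count_map; apply: eq_in_count => P P_ps /=.
    by rewrite (eqP (allP ps_block _ P_ps)).
  have /permP <- := perm_T.
  by rewrite !count_cat one same addnA addnn oddD odd_double.
exists ps, ss; split=> //.
rewrite -(size_map block ss) -(size_map (fun P => block P.1) ps).
apply: uniq_leq_size => // b /mapP[s s_ss ->].
(* A neighbor [w] of [s] lies in the same non-bipartite block. Leftover vertices have distinct
   blocks, so [w] belongs to a pair. *)
have [w e_sw] := has_neighbor s.
have ws : block w = block s.
  apply/eqP; rewrite eq_block double_cover_csym.
  apply: connect_trans (allP odd_ss _ s_ss) _.
  exact: double_cover_edge false e_sw.
have w_ss : w \notin ss.
  apply/negP => w_ss; have perm_w := perm_to_rem w_ss.
  have := ss_block; rewrite (perm_uniq (perm_map block perm_w)) /= ws.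
  case/andP => /negP + _; apply; apply: map_f.
  move: s_ss; rewrite (perm_mem perm_w) inE => /orP[/eqP sw|//].
  by rewrite sw e_irr in e_sw.
have := in_T w; rewrite !mem_cat (negbTE w_ss) orbF -ws.
case/orP => /mapP[P P_ps ->]; apply/mapP; exists P => //.
by apply/esym/eqP/(allP ps_block).
Qed.

(** * Labelings for odd moduli and for order [4 * m] *)

Lemma odd_labeling k : odd k -> (1 < k)%N -> (#|T| <= k)%N ->
  has_modular_labeling e k.
Proof.
move=> odd_k k_gt1 T_k.
have [ps [ss [perm_T ps_block odd_ss _]]] := exists_block_pairing.
have sz_T : (size ps + size ps + size ss)%N = #|T|.
  by rewrite cardE -(perm_size perm_T) !size_cat !size_map addnA.
set q := size ps in sz_T; set c := size ss in sz_T.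
(* [Y] collects what the pairs [i], [k - i] with [1 <= i <= q] leave: [0] and
   [q + 1, ..., k - q - 1]. The leftover vertices take its first [c] entries. *)
pose X := iota 1 q; pose Y := 0%N :: iota q.+1 (k - q.*2).-1.
have sz_Y : size Y = (k - q.*2)%N by rewrite /= size_iota; lia.
have /andP[uniq_ns ns_k] :
    uniq ((X ++ [seq k - i | i <- X]%N) ++ Y) &&
    all (ltn^~ k) ((X ++ [seq k - i | i <- X]%N) ++ Y).
  apply: uniq_covering.
    by rewrite size_cat sz_Y size_cat size_map size_iota; lia.
  move=> j j_k; rewrite !mem_cat inE !mem_iota.
  case: (boolP (k - q <= j)%N) => j_q; last by lia.
  suff -> : j \in [seq k - i | i <- X]%N by rewrite orbT.
  by apply/mapP; exists (k - j)%N; rewrite ?mem_iota; lia.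
have sub : subseq ((X ++ [seq k - i | i <- X]%N) ++ take c Y)
             ((X ++ [seq k - i | i <- X]%N) ++ Y).
  by apply: cat_subseq => //; apply: take_subseq.
apply: (@attainable_on_labeling k ((unzip1 ps ++ unzip2 ps) ++ ss)
         ((X ++ [seq k - i | i <- X]%N) ++ take c Y)) => //.
- apply: attainable_on_cat.
    apply: attainable_on_pairs => //; first by rewrite size_iota.
    by apply/allP => i; rewrite mem_iota; lia.
  apply: attainable_on_singles => //.
    by rewrite size_take sz_Y /c; case: ifP => //; lia.
  (* As [k] is odd, [(k + 1) / 2] is the inverse of 2 modulo [k]. *)
  move=> y _; exists (y * k.+1./2)%:R.
  rewrite -natrD -mulnDr addnn halfK /= odd_k subn0 mulnS natrD natrM.
  by rewrite char_Zp // mulr0 addr0.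
- by rewrite -catA.
- exact: subseq_uniq sub uniq_ns.
- by apply/allP => j /(mem_subseq sub) /(allP ns_k).
Qed.

Lemma even_labeling_singles m c ps ss :
  #|T| = (4 * m)%N -> perm_eq (unzip1 ps ++ unzip2 ps ++ ss) (enum T) ->
  all (fun P => block P.1 == block P.2) ps -> all odd_closed ss ->
  size ss = c.+1.*2 -> (c < m)%N -> has_modular_labeling e (4 * m)%N.
Proof.
move=> card_T perm_T ps_block odd_ss sz_ss c_m.
have sz_T : (size ps + size ps + size ss)%N = #|T|.
  by rewrite cardE -(perm_size perm_T) !size_cat !size_map addnA.
(* The single vertices take the values in [Y], all even. [X] holds the odd values below [2 * m] and
   the even ones strictly between [2 * c] and [2 * m]; reflection supplies the rest. *)
pose X := ([seq 2 * i | i <- iota c.+1 (m.-1 - c)] ++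
           [seq 2 * i + 1 | i <- iota 0 m])%N.
pose Y := ([:: 0; 2 * m] ++ [seq 2 * i | i <- iota 1 c] ++
           [seq 4 * m - 2 * i | i <- iota 1 c])%N.
have sz_X : size X = size ps by rewrite size_cat !size_map !size_iota; lia.
have sz_Y : size Y = size ss.
  by rewrite /= !size_cat !size_map !size_iota sz_ss; lia.
have /andP[uniq_ns ns_k] :
    uniq ((X ++ [seq 4 * m - i | i <- X]%N) ++ Y) &&
    all (ltn^~ (4 * m)%N) ((X ++ [seq 4 * m - i | i <- X]%N) ++ Y).
  apply: uniq_covering.
    by rewrite size_cat sz_Y size_cat size_map sz_X; lia.
  have in_X j : (j < 2 * m)%N -> odd j || (2 * c < j)%N -> j \in X.
    move=> j_m j_X; rewrite mem_cat; apply/orP.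
    case: (boolP (odd j)) => odd_j; [right | left]; apply/mapP; exists j./2;
      rewrite ?mem_iota; lia.
  have in_Y j : (j <= m)%N && (1 <= j <= c)%N ->
      ((2 * j)%N \in Y) && ((4 * m - 2 * j)%N \in Y).
    move=> j_c; rewrite !mem_cat (map_f (fun i => 2 * i)%N) ?mem_iota; last lia.
    rewrite (map_f (fun i => 4 * m - 2 * i)%N (x := j)) ?mem_iota; last lia.
    by rewrite !orbT.
  move=> j j_k; rewrite mem_cat mem_cat -orbA.
  have [j_X|j_X] := boolP ((j < 2 * m)%N && (odd j || (2 * c < j)%N)).
    by rewrite in_X //; lia.
  have [j_X'|j_X'] := boolP ((2 * m < j)%N && (odd j || (j < 4 * m - 2 * c)%N)).
    apply/or3P; apply: Or32; apply/mapP; exists (4 * m - j)%N; last lia.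
    by apply: in_X; lia.
  apply/or3P; apply: Or33.
  have [->|j_0] := eqVneq j 0%N; first by [].
  have [->|j_2m] := eqVneq j (2 * m)%N; first by rewrite !inE eqxx orbT.
  have [j_lt|j_ge] := ltnP j (2 * m)%N.
    have -> : j = (2 * j./2)%N by lia.
    by case/andP: (in_Y j./2 ltac:(lia)).
  have -> : j = (4 * m - 2 * (4 * m - j)./2)%N by lia.
  by case/andP: (in_Y (4 * m - j)./2 ltac:(lia)).
apply: (@attainable_on_labeling (4 * m)%N ((unzip1 ps ++ unzip2 ps) ++ ss)
         ((X ++ [seq 4 * m - i | i <- X]%N) ++ Y)) => //.
- by lia.
- apply: attainable_on_cat.
    apply: attainable_on_pairs => //; first by lia.
    apply/allP => i i_X; apply: ltnW; apply: (allP ns_k).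
    by rewrite mem_cat mem_cat i_X.
  apply: attainable_on_singles => // y y_Y; exists (y./2)%:R.
  rewrite -natrD addnn halfK.
  suff /negbTE -> : ~~ odd y by rewrite subn0.
  move: y_Y; rewrite !mem_cat !inE.
  by case/or3P => [/orP[]/eqP->|/mapP[i _ ->]|/mapP[i]]; rewrite ?mem_iota; lia.
- by rewrite -catA.
Qed.

Lemma even_labeling_bipartite m ps :
  (0 < m)%N -> #|T| = (4 * m)%N ->
  perm_eq (unzip1 ps ++ unzip2 ps) (enum T) ->
  all (fun P => block P.1 == block P.2) ps ->
  (forall v, ~~ odd_closed v) -> has_modular_labeling e (4 * m)%N.
Proof.
move=> m_gt0 card_T perm_T ps_block bip.
have k_gt1 : (1 < 4 * m)%N by lia.
have m4 : (3 * m + m = 4 * m)%N by lia.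
have T_gt0 : (0 < #|T|)%N by rewrite card_T; lia.
have sz_T : (size ps + size ps)%N = #|T|.
  by rewrite cardE -(perm_size perm_T) !size_cat !size_map.
have in_ps v : exists2 P, P \in ps & block P.1 = block v.
  have : v \in unzip1 ps ++ unzip2 ps by rewrite (perm_mem perm_T) mem_enum.
  rewrite mem_cat => /orP[]/mapP[P P_ps ->]; exists P => //.
  exact/eqP/(allP ps_block).
have [v _] : exists v : T, v \in T by apply/card_gt0P.
have [w e_vw] := has_neighbor v.
have [P P_ps Pv] := in_ps v; have [Q Q_ps Qw] := in_ps w.
(* Adjacent vertices in a common block would give an odd closed walk, so the pairs taken from the
   blocks of [v] and [w] differ. *)
have PQ : Q != P.
  apply/eqP => QP; have := bip w; rewrite /odd_closed.
  have : connect double_cover (v, true) (w, true).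
    by rewrite -eq_block -Pv -Qw QP.
  rewrite double_cover_csym => wv /negP; apply.
  exact: connect_trans wv (double_cover_edge true e_vw).
have perm_P := perm_to_rem P_ps.
have Q_rem : Q \in rem P ps.
  by move: Q_ps; rewrite (perm_mem perm_P) inE (negbTE PQ).
have perm_Q := perm_to_rem Q_rem.
set ps' := rem Q (rem P ps) in perm_Q.
have perm_ps : perm_eq ps (P :: Q :: ps').
  by apply: perm_trans perm_P _; rewrite perm_cons.
have sz_ps' : (size ps').+2 = size ps by rewrite (perm_size perm_ps).
pose X := (iota 1 m.-1 ++ iota m.+1 m.-1)%N.
pose Y := [:: 0; m; 2 * m; 3 * m]%N.
have sz_X : size X = size ps'.
  clear -sz_ps' sz_T card_T m_gt0; rewrite size_cat !size_iota.
  by move: (size ps') sz_ps' => q; lia.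
have [uniq_ns ns_k] := bipartite_values_uniq m_gt0.
rewrite -/X -/Y in uniq_ns ns_k.
have ps'_block : all (fun P => block P.1 == block P.2) ps'.
  by move: ps_block; rewrite (perm_all _ perm_ps) /= => /and3P[].
apply: (@attainable_on_labeling (4 * m)%N
         ((unzip1 ps' ++ unzip2 ps') ++ [:: P.1; P.2; Q.1; Q.2])
         ((X ++ [seq 4 * m - i | i <- X]%N) ++ Y)) => //.
- apply: attainable_on_cat.
    apply: attainable_on_pairs => //.
    apply/allP => i i_X; apply: ltnW; apply: (allP ns_k).
    by rewrite mem_cat mem_cat i_X.
  split=> //.
  have walk_PQ : connect double_cover (P.2, true) (Q.1, false).
    have Pv' : connect double_cover (P.2, true) (v, true).
      by rewrite -eq_block -Pv eq_sym (allP ps_block).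
    apply: connect_trans Pv' (connect_trans (double_cover_edge true e_vw) _).
    apply: (@double_cover_flip (w, true) (Q.1, true)).
    by rewrite -eq_block Qw.
  have walk_Q : connect double_cover (Q.1, true) (Q.2, true).
    by rewrite -eq_block (allP ps_block).
  (* The odd walk adds [m] at [P.2] and [Q.1], the even one [m] at [Q.1] and [-m] at [Q.2]. So
     [P.1], [P.2], [Q.1], [Q.2] receive [0], [m], [2 * m], [3 * m]. *)
  apply: eq_attainable (attainableD (attainable_walk m%:R walk_PQ)
                                    (attainable_walk m%:R walk_Q)) => z /=.
  rewrite !big_cons big_nil /=.
  have m3 : (3 * m)%:R = - m%:R :> 'Z_(4 * m).
    apply/eqP; rewrite -subr_eq0 opprK -natrD m4.
    by rewrite char_Zp.
  by rewrite m3 natrM; ring.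
- apply: perm_trans perm_T; apply/permP => a.
  have /permP /(_ a) /= := perm_map fst perm_ps.
  have /permP /(_ a) /= := perm_map snd perm_ps.
  by rewrite !count_cat /= /unzip1 /unzip2; clear; lia.
Qed.

Lemma even_labeling m : (0 < m)%N -> #|T| = (4 * m)%N ->
  has_modular_labeling e (4 * m)%N.
Proof.
move=> m_gt0 card_T.
have [ps [ss [perm_T ps_block odd_ss sz_le]]] := exists_block_pairing.
have sz_T : (size ps + size ps + size ss)%N = #|T|.
  by rewrite cardE -(perm_size perm_T) !size_cat !size_map addnA.
case: ss => [|s ss] in perm_T odd_ss sz_le sz_T *; last first.
  (* The leftover vertices are even in number and at most a third of all, hence [c < m]. Here [ss]
     is the tail of their list, of odd size [2 * c + 1]. *)
  apply: (even_labeling_singles (c := (size ss)./2)) perm_T _ _ _ _ => //;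
    move: sz_T sz_le ; rewrite card_T /=; clear; lia.
rewrite cats0 in perm_T.
have [/existsP[v odd_v]|/existsPn bip] := boolP [exists v, odd_closed v];
  last first.
  exact: even_labeling_bipartite perm_T ps_block bip.
have [P P_ps Pv] : exists2 P, P \in ps & block P.1 = block v.
  have : v \in unzip1 ps ++ unzip2 ps by rewrite (perm_mem perm_T) mem_enum.
  rewrite mem_cat => /orP[]/mapP[P P_ps ->]; exists P => //.
  exact/eqP/(allP ps_block).
have perm_ps := perm_to_rem P_ps.
(* A pair in a non-bipartite component is split into two single vertices, taking [0] and [2 * m]. *)
apply: (even_labeling_singles (c := 0) (ps := rem P ps)
                              (ss := [:: P.1; P.2])) => //.
- apply: perm_trans perm_T; apply/permP => a.
  have /permP /(_ a) /= := perm_map fst perm_ps.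
  have /permP /(_ a) /= := perm_map snd perm_ps.
  by rewrite !count_cat /= /unzip1 /unzip2; clear; lia.
- by move: ps_block; rewrite (perm_all _ perm_ps) /= => /andP[].
- rewrite /= (odd_closed_block (esym Pv)) // (odd_closed_block _ odd_v) //.
  by rewrite -Pv; apply/eqP/(allP ps_block).
Qed.

(** * The obstruction when the order is 2 modulo 4 *)

(** Every edge is counted at both ends. Comparing ranks picks one orientation, so [a] is the sum of
    all edge labels. *)
Lemma sum_induced_label k (f : {set T} -> 'Z_k) :
  exists a, \sum_u induced_label e f u = a + a.
Proof.
exists (\sum_u \sum_(v | e u v && (enum_rank u < enum_rank v)%N) f [set u; v]).
pose lt (u v : T) := (enum_rank u < enum_rank v)%N.
rewrite [X in _ = _ + X](exchange_big_dep xpredT) //= -big_split.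
apply: eq_bigr => u _ /=.
rewrite /induced_label (bigID (lt u)) /=; congr (_ + _).
apply: eq_big => [v|v _]; last by rewrite setUC.
rewrite e_sym; case: (boolP (e v u)) => //= e_vu.
rewrite /lt -leqNgt leq_eqVlt; case: eqP => // /val_inj /enum_rank_inj vu.
by rewrite vu e_irr in e_vu.
Qed.

(* The induced labels would sum to n/2 mod n, an odd number, whereas each edge
   contributes twice to that sum. *)
Lemma no_labeling_2mod4 k :
  #|T| = k -> k = 2 %[mod 4] -> ~ has_modular_labeling e k.
Proof.
case: k => [|[|k]] // card_T mod_T [f f_inj].
have lab_bij : bijective (induced_label e f).
  by apply: inj_card_bij => //; rewrite card_T card_ord.
have [a] := sum_induced_label f.
have -> : \sum_u induced_label e f u = \sum_(x : 'Z_k.+2) x.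
  by rewrite [RHS](reindex (induced_label e f)) //; apply: onW_bij.
have -> : \sum_(x : 'Z_k.+2) x = (\sum_(i < k.+2) i)%N%:R :> 'Z_k.+2.
  by rewrite natr_sum; apply: eq_bigr => i _; rewrite natr_Zp.
rewrite -(big_mkord xpredT (fun i => i)) bin2_sum.
(* With [n] the order, multiplying by [n / 2] annihilates [a + a] modulo [n]. So [n], hence also 2,
   would divide [(n / 2)^2 * (n - 1)], which is odd. *)
move=> /(congr1 (fun x => x *+ k.+2./2)).
rewrite -mulr2n -!mulrnA [(2 * _)%N](_ : _ = k.+2); last by lia.
rewrite -[a *+ _]mulr_natr char_Zp // mulr0 => /(congr1 val).
rewrite /= val_Zp_nat // => /eqP; rewrite -/(dvdn _ _).
move/(dvdn_trans (n := k.+2)) => dvd.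
have : (2 %| 'C(k.+2, 2) * k.+2./2)%N by apply: dvd; lia.
have -> : 'C(k.+2, 2) = (k.+2./2 * k.+1)%N.
  have k_double : k.+2 = (k.+2./2).*2 by lia.
  by rewrite bin2 {1}k_double -doubleMl doubleK.
by rewrite !dvdn2 !oddM; lia.
Qed.

End Attainable.

Theorem theorem1p5 (T : finType) (e : rel T) (n : nat)
    (e_sym : symmetric e) (e_irr : irreflexive e)
    (order_n : #|T| = n)
    (no_small_component : forall C : {set T}, C \in components e -> 3 <= #|C|)
    (even_color_classes : forall C A B : {set T}, C \in components e ->
       color_classes e C A B -> ~~ odd #|A| /\ ~~ odd #|B|) :
  (n <> 2 %[mod 4] -> modular_edge_gracefulness e n) /\
  (n = 2 %[mod 4] -> modular_edge_gracefulness e n.+1).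
Proof.
have comp_v v : [set u in [set: T] | connect e v u] \in components e.
  exact: imset_f.
have nbr v : exists w, e v w.
  have := no_small_component _ (comp_v v); rewrite (cardsD1 v) => sz.
  have /card_gt0P[u] : 0 < #|[set u in [set: T] | connect e v u] :\ v| by lia.
  rewrite !inE => /andP[uv /connectP[[|w p] /= p_path u_last]].
    by rewrite u_last eqxx in uv.
  by exists w; case/andP: p_path.
have bip_even v : ~~ odd_closed e v ->
    ~~ odd #|[set u | connect (double_cover e) (v, true) (u, true)]|.
  move=> bip_v; have cc := bipartite_color_classes e_sym bip_v.
  by have [] := even_color_classes _ _ _ (comp_v v) cc.
have n_neq1 : n != 1.
  apply/eqP => n1; have /card_gt0P[v _] : 0 < #|T| by rewrite order_n n1.
  have := no_small_component _ (comp_v v).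
  by have := max_card [set u in [set: T] | connect e v u]; lia.
split=> n_mod; split; rewrite ?order_n //.
(* The empty graph is treated apart, as the constructions need a modulus above 1. *)
- have [n0|n_gt0] := posnP n.
    by exists (fun _ => 0%R) => u; case: (fintype0 u); rewrite order_n.
  have [odd_n|even_n] := boolP (odd n).
    by apply: odd_labeling => //; lia.
  have -> : n = 4 * (n %/ 4) by lia.
  by apply: even_labeling => //; lia.
- by apply: odd_labeling => //; lia.
- move=> k; rewrite leq_eqVlt => /orP[/eqP <-|//].
  by move=> lab; case: (no_labeling_2mod4 e_sym e_irr order_n n_mod lab).
Qed.
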